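(* Let $3\le\alpha<\omega$. The class $TPEA_\alpha$ is term-definitionally equivalent to the class $PEA_\alpha$ of polyadic equality algebras of dimension $\alpha$.
   Context: $TPEA_\alpha$ is the class of all algebras $\langle A,+,-,c_i,d_{ij},p_{ij}\rangle_{i,j<\alpha}$ ($+$ binary; $-,c_i,p_{ij}$ unary; $d_{ij}$ constants) in which an equational axiom set CAx for cylindric algebras of dimension $\alpha$, in the language $+,-,c_i,d_{ij}$ (any such axiom set may be taken), and the following (P1)--(P8) hold, for all $i,j,k,l<\alpha$, where $\tau=[i,j]$ interchanges $i,j$ and fixes all else: (P1) $p_{ij}(x+y)=p_{ij}x+p_{ij}y$; (P2) $p_{ij}(-x)=-p_{ij}x$; (P3) $p_{ij}(c_kx)=c_{\tau(k)}p_{ij}x$; (P4) $p_{ij}d_{kl}=d_{\tau(k)\tau(l)}$; (P5) $p_{ij}p_{kl}x=p_{\tau(k)\tau(l)}p_{ij}x$; (P6) $p_{ij}p_{ij}x=x$; (P7) $p_{ii}x=x$; (P8) $p_{ij}(x\cdot d_{ij})=x\cdot d_{ij}$. Here $x\cdot y=-(-x+-y)$, and $0,1$ are the Boolean constants. Cylindric algebras of dimension $\alpha$ are axiomatized by: $+,-$ form a Boolean algebra; $c_i0=0$; $x\le c_ix$; $c_i(x\cdot c_iy)=c_ix\cdot c_iy$; $c_ic_jx=c_jc_ix$; $d_{ii}=1$; $d_{ij}=c_k(d_{ik}\cdot d_{kj})$ if $k\notin\{i,j\}$; $c_i(d_{ij}\cdot x)\cdot c_i(d_{ij}\cdot -x)=0$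 if $i\neq j$. $PEA_\alpha$ is the class of all algebras $\langle A,+,-,c_{(\Gamma)},s_\tau,d_{ij}\rangle$, with unary operations $c_{(\Gamma)}$ for $\Gamma\subseteq\alpha$, unary operations $s_\tau$ for all functions $\tau:\alpha\to\alpha$, and constants $d_{ij}$ for $i,j<\alpha$, such that for all $\Gamma,\Delta\subseteq\alpha$, $\sigma,\tau:\alpha\to\alpha$, $i,j<\alpha$: $+,-$ form a Boolean algebra; $c_{(\Gamma)}0=0$; $x\le c_{(\Gamma)}x$; $c_{(\Gamma)}(x\cdot c_{(\Gamma)}y)=c_{(\Gamma)}x\cdot c_{(\Gamma)}y$; $c_{(\emptyset)}x=x$; $c_{(\Gamma)}c_{(\Delta)}x=c_{(\Gamma\cup\Delta)}x$; $s_\tau$ is a Boolean endomorphism; $s_{Id}x=x$; $s_{\sigma\circ\tau}x=s_\sigma s_\tau x$, where $(\sigma\circ\tau)(i)=\sigma(\tau(i))$; if $\sigma$ and $\tau$ agree on $\alpha\setminus\Gamma$ then $s_\sigma c_{(\Gamma)}x=s_\tau c_{(\Gamma)}x$; if $\Delta=\tau^{-1}[\Gamma]$ and $\tau$ is injective on $\Delta$ then $c_{(\Gamma)}s_\tau x=s_\tau c_{(\Delta)}x$; $d_{ii}=1$; $x\cdot d_{ij}\le s_{[i/j]}x$, where $[i/j]$ maps $i$ to $j$ and fixes everything else; $s_\tau d_{ij}=d_{\tau(i)\tau(j)}$. Two classes $K,L$ of algebras (possibly of different similarity types) are term-definitionally equivalent if each basic operation of $L$ can be given by a term in the language of $K$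 and each basic operation of $K$ by a term in the language of $L$, in such a way that the algebras so defined from members of $K$ are in $L$, those so defined from members of $L$ are in $K$, and the two resulting constructions are inverse to each other. *)

(* Defs.v *)
From mathcomp Require Import all_boot all_fingroup.

Set Implicit Arguments.
Unset Strict Implicit.
Unset Printing Implicit Defensive.

(** * Algebras, terms and term-definitional equivalence *)

Record signature := Signature {
  symbol : Type;
  arity : symbol -> nat
}.

Record algebra (S : signature) := Algebra {
  carrier :> Type;
  op : forall o : symbol S, (arity o).-tuple carrier -> carrier
}.
Arguments op {S} a o.

Inductive term (S : signature) (m : nat) : Type :=
| Var of 'I_m
| App (o : symbol S) of ('I_(arity o) -> term S m).
Arguments Var {S m}.
Arguments App {S m}.

Fixpoint eval (S : signature) (A : algebra S) (m : nat) (v : m.-tuple A)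
    (t : term S m) : A :=
  match t with
  | Var i => tnth v i
  | App o ts => op A o [tuple eval v (ts i) | i < arity o]
  end.

Definition interpretation (S T : signature) : Type :=
  forall o : symbol T, term S (arity o).

Definition derived (S T : signature) (I : interpretation S T)
    (A : algebra S) : algebra T :=
  @Algebra T A (fun o v => eval v (I o)).

(* [derived] keeps the carrier, so that [derived J (derived I A)] and [A]
   are the same algebra as soon as their operations agree. *)
Definition term_definitionally_equivalent (S T : signature)
    (K : algebra S -> Prop) (L : algebra T -> Prop) : Prop :=
  exists (I : interpretation S T) (J : interpretation T S),
    [/\ forall A, K A -> L (derived I A),
        forall B, L B -> K (derived J B),
        forall A, K A -> forall o v, op (derived J (derived I A)) o v = op A o v
      & forall B, L B -> forall o v, op (derived I (derived J B)) o v = op B o v].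

(** * Identities, stated over the basic operations *)

Section Identities.
Variables (A : Type) (add : A -> A -> A) (neg : A -> A).

Definition meet (x y : A) : A := neg (add (neg x) (neg y)).
Definition le (x y : A) : Prop := add x y = y.

Local Notation "x ⊕ y" := (add x y) (at level 50, left associativity).
Local Notation "x ⊙ y" := (meet x y) (at level 40, left associativity).
Local Notation "⊖ x" := (neg x) (at level 35, right associativity).
Local Notation "x ≼ y" := (le x y) (at level 70, no associativity).

(* The languages have no symbols for the Boolean constants: 0 is written
   [x ⊙ ⊖ x] and 1 is written [x ⊕ ⊖ x], for arbitrary [x]. *)
Record boolean_axioms : Prop := BooleanAxioms {
  ba_addC x y : x ⊕ y = y ⊕ x;
  ba_meetC x y : x ⊙ y = y ⊙ x;
  ba_addA x y z : x ⊕ (y ⊕ z) = (x ⊕ y) ⊕ z;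
  ba_meetA x y z : x ⊙ (y ⊙ z) = (x ⊙ y) ⊙ z;
  ba_addK x y : x ⊕ (x ⊙ y) = x;
  ba_meetK x y : x ⊙ (x ⊕ y) = x;
  ba_meetDr x y z : x ⊙ (y ⊕ z) = (x ⊙ y) ⊕ (x ⊙ z);
  ba_addMr x y z : x ⊕ (y ⊙ z) = (x ⊕ y) ⊙ (x ⊕ z);
  ba_add0 x y : x ⊕ (y ⊙ ⊖ y) = x;
  ba_meet1 x y : x ⊙ (y ⊕ ⊖ y) = x
}.

Section Cylindric.
Variables (n : nat) (c : 'I_n -> A -> A) (d : 'I_n -> 'I_n -> A).

Record cylindric_axioms : Prop := CylindricAxioms {
  ca_boolean : boolean_axioms;
  ca_c0 i x : c i (x ⊙ ⊖ x) = x ⊙ ⊖ x;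
  ca_le_c i x : x ≼ c i x;
  ca_c_meet i x y : c i (x ⊙ c i y) = c i x ⊙ c i y;
  ca_cC i j x : c i (c j x) = c j (c i x);
  ca_d_refl i x : d i i = x ⊕ ⊖ x;
  ca_d_trans i j k : k != i -> k != j -> d i j = c k (d i k ⊙ d k j);
  ca_d_meet i j x : i != j ->
    c i (d i j ⊙ x) ⊙ c i (d i j ⊙ ⊖ x) = x ⊙ ⊖ x
}.

Variable p : 'I_n -> 'I_n -> A -> A.

Record tpea_axioms : Prop := TpeaAxioms {
  tpea_cylindric : cylindric_axioms;
  tpea_p_add i j x y : p i j (x ⊕ y) = p i j x ⊕ p i j y;
  tpea_p_neg i j x : p i j (⊖ x) = ⊖ p i j x;
  tpea_p_c i j k x : p i j (c k x) = c (tperm i j k) (p i j x);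
  tpea_p_d i j k l : p i j (d k l) = d (tperm i j k) (tperm i j l);
  tpea_p_p i j k l x :
    p i j (p k l x) = p (tperm i j k) (tperm i j l) (p i j x);
  tpea_pK i j x : p i j (p i j x) = x;
  tpea_p_refl i x : p i i x = x;
  tpea_p_meet_d i j x : p i j (x ⊙ d i j) = x ⊙ d i j
}.

End Cylindric.

Section Polyadic.
Variables (n : nat) (c : {set 'I_n} -> A -> A).
Variables (s : {ffun 'I_n -> 'I_n} -> A -> A) (d : 'I_n -> 'I_n -> A).

Implicit Types (G D : {set 'I_n}) (r t : {ffun 'I_n -> 'I_n}).

Record pea_axioms : Prop := PeaAxioms {
  pea_boolean : boolean_axioms;
  pea_c0 G x : c G (x ⊙ ⊖ x) = x ⊙ ⊖ x;
  pea_le_c G x : x ≼ c G x;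
  pea_c_meet G x y : c G (x ⊙ c G y) = c G x ⊙ c G y;
  pea_c_set0 x : c set0 x = x;
  pea_c_setU G D x : c G (c D x) = c (G :|: D) x;
  pea_s_add t x y : s t (x ⊕ y) = s t x ⊕ s t y;
  pea_s_neg t x : s t (⊖ x) = ⊖ s t x;
  pea_s_id x : s [ffun i => i] x = x;
  pea_s_comp r t x : s [ffun i => r (t i)] x = s r (s t x);
  pea_s_c G r t x : {in ~: G, r =1 t} -> s r (c G x) = s t (c G x);
  pea_c_s G D t x : D = t @^-1: G -> {in D &, injective t} ->
    c G (s t x) = s t (c D x);
  pea_d_refl i x : d i i = x ⊕ ⊖ x;
  pea_meet_d_le i j x : x ⊙ d i j ≼ s [ffun k => if k == i then j else k] x;
  pea_s_d t i j : s t (d i j) = d (t i) (t j)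
}.

End Polyadic.
End Identities.

(** * The two classes *)

Variant tpea_symbol (n : nat) : Type :=
| TAdd
| TNeg
| TCyl of 'I_n
| TDiag of 'I_n & 'I_n
| TPerm of 'I_n & 'I_n.
Arguments TAdd {n}.
Arguments TNeg {n}.

Definition tpea_signature (n : nat) : signature :=
  @Signature (tpea_symbol n) (fun o =>
    match o with
    | TAdd => 2
    | TNeg | TCyl _ | TPerm _ _ => 1
    | TDiag _ _ => 0
    end).

Definition TPEA (n : nat) (A : algebra (tpea_signature n)) : Prop :=
  tpea_axioms
    (fun x y => op A TAdd [tuple x; y])
    (fun x => op A TNeg [tuple x])
    (fun i x => op A (TCyl i) [tuple x])
    (fun i j => op A (TDiag i j) [tuple])
    (fun i j x => op A (TPerm i j) [tuple x]).

Variant pea_symbol (n : nat) : Type :=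
| PAdd
| PNeg
| PCyl of {set 'I_n}
| PSubst of {ffun 'I_n -> 'I_n}
| PDiag of 'I_n & 'I_n.
Arguments PAdd {n}.
Arguments PNeg {n}.

Definition pea_signature (n : nat) : signature :=
  @Signature (pea_symbol n) (fun o =>
    match o with
    | PAdd => 2
    | PNeg | PCyl _ | PSubst _ => 1
    | PDiag _ _ => 0
    end).

Definition PEA (n : nat) (A : algebra (pea_signature n)) : Prop :=
  pea_axioms
    (fun x y => op A PAdd [tuple x; y])
    (fun x => op A PNeg [tuple x])
    (fun G x => op A (PCyl G) [tuple x])
    (fun t x => op A (PSubst t) [tuple x])
    (fun i j => op A (PDiag i j) [tuple]).

(* Main.v *)
Require Import Defs.
From mathcomp Require Import all_boot all_fingroup.
From Stdlib Require Import FunctionalExtensionality.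

(** A transformation of a finite set is a composition of transpositions
    [i,j] and replacements [i/j].  On the transpositional side the first are
    the operations p_ij, and the second can be written x |-> c_i (d_ij . x).
    So s_t is defined by choosing a word of such generators for t
    ([word_of]), c_(G) by iterating the c_i with i in G ([cylset]), and
    conversely p_ij is s_[i,j] and c_i is c_({i}).

    The crux is that two words for the same transformation t define the same
    operation ([eq_word_op]).  Set-theoretically, a sequence f lies in s_t x
    exactly when it agrees on the image of t with some g for which g o r is
    constant on the kernel classes of t and lies in x; here r is any
    permutation such that r^-1, restricted to the image of t, is a section of
    t.  Algebraically every word for t can be brought to the normal form
    c_(complement of the image of t) r (x . D_t), with D_t the product of the
    d_ij with t i = t j ([word_op_normal_form]).  Prefixing one generator
    preserves this form.  The form does not depend on r: two choices differ by
    a permutation which is a product of transpositions that either exchange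
    two coordinates identified by the diagonal factor, and so act trivially
    by [tpea_p_meet_d], or exchange two cylindrified coordinates
    ([cylset_pact_retract]).  The permutations act in the first place because
    [tpea_p_p], [tpea_pK] and [tpea_p_refl] contain the relations between
    transpositions ([p_sift]).

    Once s_t is independent of the word, s_(r o t) = s_r s_t is concatenation
    of words, and the Boolean and diagonal axioms are checked generator by
    generator.  The two axioms relating s_t and c_(G) are [word_op_cylset],
    where c_i x absorbs a replacement [i/j], and [cylset_word_op], which is
    read off the normal form.

    Conversely, in a polyadic equality algebra s_[i/j] x = c_i (d_ij . x)
    ([pea_replace]), which yields the cylindric axioms on diagonals;
    that p_ij fixes x . d_ij is [swap_meet_d].  As the generators are the same
    on both sides, translating back and forth restores every operation.  The
    defining terms themselves are obtained by performing the constructions in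
    the term algebra. *)

Set Implicit Arguments.
Unset Strict Implicit.
Unset Printing Implicit Defensive.

(** * Boolean algebras and quantifiers *)

Section BooleanFacts.
Variables (A : Type) (add : A -> A -> A) (neg : A -> A).
Hypothesis BA : boolean_axioms add neg.
Implicit Types x y z : A.

Local Notation "x ⊕ y" := (add x y) (at level 50, left associativity).
Local Notation "x ⊙ y" := (meet add neg x y) (at level 40, left associativity).
Local Notation "⊖ x" := (neg x) (at level 35, right associativity).
Local Notation "x ≼ y" := (le add x y) (at level 70, no associativity).

Lemma add_idem x : x ⊕ x = x.
Proof. by rewrite -{2}(ba_meetK BA x x) (ba_addK BA). Qed.

Lemma meet_idem x : x ⊙ x = x.
Proof. by rewrite -{2}(ba_addK BA x x) (ba_meetK BA). Qed.

Lemma le_refl x : x ≼ x.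
Proof. exact: add_idem. Qed.

Lemma le_trans y x z : x ≼ y -> y ≼ z -> x ≼ z.
Proof. by rewrite /le => xy yz; rewrite -yz (ba_addA BA) xy. Qed.

Lemma le_anti x y : x ≼ y -> y ≼ x -> x = y.
Proof. by rewrite /le (ba_addC BA) => xy <-. Qed.

Lemma meet_leP x y : x ≼ y <-> x ⊙ y = x.
Proof.
split=> [<-|<-]; first exact: (ba_meetK BA).
by rewrite /le (ba_addC BA) (ba_meetC BA) (ba_addK BA).
Qed.

Lemma meet_lel x y : x ⊙ y ≼ x.
Proof. by rewrite /le (ba_addC BA) (ba_addK BA). Qed.

Lemma meet_ler x y : x ⊙ y ≼ y.
Proof. by rewrite (ba_meetC BA); apply: meet_lel. Qed.

Lemma le_meet z x y : z ≼ x -> z ≼ y -> z ≼ x ⊙ y.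
Proof.
move=> /meet_leP zx /meet_leP zy; apply/meet_leP.
by rewrite (ba_meetA BA) zx zy.
Qed.

Lemma le_addl x y : x ≼ x ⊕ y.
Proof. by rewrite /le (ba_addA BA) add_idem. Qed.

Lemma le_addr x y : y ≼ x ⊕ y.
Proof. by rewrite (ba_addC BA); apply: le_addl. Qed.

Lemma add_le z x y : x ≼ z -> y ≼ z -> x ⊕ y ≼ z.
Proof. by rewrite /le -(ba_addA BA) => xz ->. Qed.

Lemma bot_le y x : y ⊙ ⊖ y ≼ x.
Proof. by rewrite /le (ba_addC BA) (ba_add0 BA). Qed.

Lemma le_top x y : x ≼ y ⊕ ⊖ y.
Proof. by apply/meet_leP; rewrite (ba_meet1 BA). Qed.

Lemma bot_eq x y : x ⊙ ⊖ x = y ⊙ ⊖ y.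
Proof. by apply: le_anti; apply: bot_le. Qed.

Lemma negK x : ⊖ ⊖ x = x.
Proof. by rewrite -{2}(meet_idem x) /meet add_idem. Qed.

Lemma neg_meet x y : ⊖ (x ⊙ y) = ⊖ x ⊕ ⊖ y.
Proof. by rewrite /meet negK. Qed.

Lemma add_meet x y : x ⊕ y = ⊖ (⊖ x ⊙ ⊖ y).
Proof. by rewrite neg_meet !negK. Qed.

(** Here and below z only names the Boolean constants, as z . -z and z + -z. *)
Lemma le_disj z x y : x ⊙ ⊖ y ≼ z ⊙ ⊖ z -> x ≼ y.
Proof.
move=> xy0; rewrite -[x](ba_meet1 BA x y) (ba_meetDr BA).
apply: add_le; first exact: meet_ler.
exact: le_trans xy0 (bot_le _ _).
Qed.

Lemma neg_unique z x y :
  x ⊙ y ≼ z ⊙ ⊖ z -> z ⊕ ⊖ z ≼ x ⊕ y -> y = ⊖ x.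
Proof.
move=> xy0 xy1; apply: le_anti.
  by apply: (@le_disj z); rewrite negK (ba_meetC BA).
have nx: ⊖ x ⊙ (x ⊕ y) = ⊖ x.
  by apply/meet_leP/(le_trans _ xy1)/le_top.
rewrite -nx (ba_meetDr BA); apply: add_le; last exact: meet_ler.
by rewrite (ba_meetC BA); apply: bot_le.
Qed.

Section Homomorphism.
Variable f : A -> A.
Hypotheses (fD : forall x y, f (x ⊕ y) = f x ⊕ f y)
           (fN : forall x, f (⊖ x) = ⊖ f x).

Lemma hom_meet x y : f (x ⊙ y) = f x ⊙ f y.
Proof. by rewrite /meet fN fD !fN. Qed.

Lemma hom_mono x y : x ≼ y -> f x ≼ f y.
Proof. by rewrite /le -fD => ->. Qed.

End Homomorphism.

Section Quantifier.
Variable q : A -> A.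
Hypotheses (q0 : forall x, q (x ⊙ ⊖ x) = x ⊙ ⊖ x)
           (le_q : forall x, x ≼ q x)
           (q_meet : forall x y, q (x ⊙ q y) = q x ⊙ q y).

Lemma quant_idem x : q (q x) = q x.
Proof.
apply: le_anti (le_q _); apply/meet_leP.
by rewrite -q_meet meet_idem.
Qed.

Lemma quant_mono x y : x ≼ y -> q x ≼ q y.
Proof.
move=> xy; have /meet_leP <- : x ≼ q y by apply: le_trans xy (le_q y).
by rewrite q_meet; apply: meet_ler.
Qed.

Lemma quant_meet_fix x y : q x = x -> q (x ⊙ y) = x ⊙ q y.
Proof. by move=> qx; rewrite (ba_meetC BA) -{1}qx q_meet qx (ba_meetC BA). Qed.

Lemma quant_fix_meet x y : q x = x -> q y = y -> q (x ⊙ y) = x ⊙ y.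
Proof. by move=> qx qy; rewrite quant_meet_fix // qy. Qed.

(** The elements fixed by q form a Boolean subalgebra, which makes q additive. *)
Lemma quant_fix_neg x : q x = x -> q (⊖ x) = ⊖ x.
Proof.
move=> qx; apply: le_anti (le_q _); apply: (@le_disj x); rewrite negK.
rewrite (ba_meetC BA) -quant_meet_fix // q0; exact: le_refl.
Qed.

Lemma quant_fix_add x y : q x = x -> q y = y -> q (x ⊕ y) = x ⊕ y.
Proof.
move=> qx qy; rewrite add_meet quant_fix_neg //.
by apply: quant_fix_meet; apply: quant_fix_neg.
Qed.

Lemma quant_add x y : q (x ⊕ y) = q x ⊕ q y.
Proof.
apply: le_anti; last first.
  by apply: add_le; apply: quant_mono; [apply: le_addl | apply: le_addr].
have <-: q (q x ⊕ q y) = q x ⊕ q y by apply: quant_fix_add; apply: quant_idem.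
apply: quant_mono; apply: add_le.
  exact: le_trans (le_q x) (le_addl _ _).
exact: le_trans (le_q y) (le_addr _ _).
Qed.

End Quantifier.
End BooleanFacts.

(** * Finite transformations as words *)

(** [inl (i, j)] stands for the transposition [i,j] and [inr (i, j)] for the
    replacement [i/j]. *)
Definition gen (n : nat) : Type := ('I_n * 'I_n + 'I_n * 'I_n)%type.

Definition gen_fun (n : nat) (g : gen n) (k : 'I_n) : 'I_n :=
  match g with
  | inl ij => tperm ij.1 ij.2 k
  | inr ij => if k == ij.1 then ij.2 else k
  end.

Definition word_fun (n : nat) (w : seq (gen n)) (k : 'I_n) : 'I_n :=
  foldr (@gen_fun n) k w.

Lemma word_fun_cat n (w w' : seq (gen n)) k :
  word_fun (w ++ w') k = word_fun w (word_fun w' k).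
Proof. by rewrite /word_fun foldr_cat. Qed.

Lemma perm_tperm_ind (T : finType) (P : {perm T} -> Prop) :
  P 1%g -> (forall r i j, P r -> P (r * tperm i j)%g) -> forall r, P r.
Proof.
move=> P1 PM r; have [ts -> _] := prod_tpermP r.
elim/last_ind: ts => [|ts t IHts]; first by rewrite big_nil.
by rewrite -cats1 big_cat big_seq1; apply: PM.
Qed.

(** A non-injective t takes the same value at some a != b and misses some c0.
    Sending a to c0 instead enlarges the image, and t is recovered by composing
    with the replacement [c0/t a]; so induction reduces to permutations. *)
Lemma word_fun_surj n (t : 'I_n -> 'I_n) : exists w, word_fun w =1 t.
Proof.
have [m] := ubnP #|[set k | k \notin codom t]|; elim: m t => // m IHm t.
rewrite ltnS => le_m.
have [/injectiveP t_inj|/injectivePn[a [b ab tab]]] := boolP (injectiveb t).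
  suff: forall r : {perm 'I_n}, exists w, word_fun w =1 r.
    by case/(_ (perm t_inj)) => w wE; exists w => k; rewrite wE permE.
  elim/perm_tperm_ind => [|r i j [w wE]]; first by exists [::] => k; rewrite perm1.
  by exists (inl (i, j) :: w) => k; rewrite /= -/(word_fun w k) wE permM.
(* An injective self-map of a finite set is onto, so t misses some point. *)
have [c0 c_out] : exists c0, c0 \notin codom t.
  apply/existsP; rewrite -[[exists _, _]]negbK negb_exists.
  apply/negP => /forallP t_onto.
  have /injectiveP t_inj : injectiveb t.
    rewrite /injectiveb /dinjectiveb -/(codom t); apply/card_uniqP.
    rewrite size_codom; apply: eq_card => k; have := t_onto k; rewrite negbK inE.
    by move->.
  by case/eqP: ab; apply: t_inj.
pose t' k := if k == a then c0 else t k.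
have [|w wE] := IHm t'.
  apply: leq_trans le_m; apply/proper_card/properP; split.
    apply/subsetP => k; rewrite !inE; apply: contra => /codomP[l ->].
    have [->|la] := eqVneq l a.
      by rewrite tab; apply/codomP; exists b; rewrite /t' eq_sym (negPf ab).
    by apply/codomP; exists l; rewrite /t' (negPf la).
  exists c0; rewrite !inE // negbK; apply/codomP; exists a.
  by rewrite /t' eqxx.
exists (inr (c0, t a) :: w) => k; rewrite /= -/(word_fun w k) wE /t'.
have [->|ka] := eqVneq k a; first by rewrite eqxx.
by case: eqP => // tk; case/negP: c_out; apply/codomP; exists k.
Qed.

Lemma word_existsb n (t : {ffun 'I_n -> 'I_n}) :
  exists w : seq (gen n), [forall k, word_fun w k == t k].
Proof.
by have [w wE] := word_fun_surj t; exists w; apply/forallP => k; rewrite wE.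
Qed.

Definition word_of n (t : {ffun 'I_n -> 'I_n}) : seq (gen n) :=
  xchoose (word_existsb t).

Lemma word_ofE n (t : {ffun 'I_n -> 'I_n}) : word_fun (word_of t) =1 t.
Proof.
by move=> k; apply/eqP; move: k; apply/forallP/(xchooseP (word_existsb t)).
Qed.

(** * Cylindric algebras with transpositions *)

Section Transpositional.
Variables (A : Type) (add : A -> A -> A) (neg : A -> A) (n : nat).
Variables (c : 'I_n -> A -> A) (d : 'I_n -> 'I_n -> A).
Variable p : 'I_n -> 'I_n -> A -> A.
Hypothesis TP : tpea_axioms add neg c d p.
Implicit Types (x y z : A) (i j k : 'I_n) (G : {set 'I_n}).

Local Notation "x ⊕ y" := (add x y) (at level 50, left associativity).
Local Notation "x ⊙ y" := (meet add neg x y) (at level 40, left associativity).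
Local Notation "⊖ x" := (neg x) (at level 35, right associativity).
Local Notation "x ≼ y" := (le add x y) (at level 70, no associativity).

Let CA := tpea_cylindric TP.
Let BA := ca_boolean CA.

Let c_idem i := quant_idem BA (ca_le_c CA i) (ca_c_meet CA i).
Let c_mono i := quant_mono BA (ca_le_c CA i) (ca_c_meet CA i).
Let c_meet_fix i := quant_meet_fix BA (ca_c_meet CA i).

Definition cyl (l : seq 'I_n) x := foldr c x l.
Definition cylset G x := cyl (enum G) x.

Lemma le_cyl l x : x ≼ cyl l x.
Proof.
elim: l => [|i l IHl] /=; first exact: (le_refl BA).
exact: (le_trans BA IHl (ca_le_c CA _ _)).
Qed.

Lemma cyl_fix l i x : i \in l -> c i (cyl l x) = cyl l x.
Proof.
elim: l => //= j l IHl; rewrite inE => /predU1P[->|/IHl il].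
  exact: c_idem.
by rewrite (ca_cC CA) il.
Qed.

Lemma cyl_mono l x y : x ≼ y -> cyl l x ≼ cyl l y.
Proof. by elim: l => //= i l IHl /IHl; apply: c_mono. Qed.

Lemma cyl_id l x : (forall i, i \in l -> c i x = x) -> cyl l x = x.
Proof.
elim: l => //= i l IHl fix_x; rewrite IHl ?fix_x ?mem_head // => j jl.
by rewrite fix_x // inE jl orbT.
Qed.

(** The elements fixed by all c_i, i in l, are scalars for the quantifier c_(l). *)
Lemma cyl_meet l x y :
  (forall i, i \in l -> c i x = x) -> cyl l (x ⊙ y) = x ⊙ cyl l y.
Proof.
elim: l => //= i l IHl fix_x; rewrite IHl => [|j jl].
  by rewrite c_meet_fix ?fix_x ?mem_head.
by rewrite fix_x // inE jl orbT.
Qed.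

Lemma cyl_sub l l' x : {subset l <= l'} -> cyl l x ≼ cyl l' x.
Proof.
move=> sub; rewrite -[X in _ ≼ X](@cyl_id l) => [|i /sub]; last exact: cyl_fix.
by apply: cyl_mono; apply: le_cyl.
Qed.

Lemma eq_cyl l l' x : l =i l' -> cyl l x = cyl l' x.
Proof. by move=> ll; apply: (le_anti BA); apply: cyl_sub => i; rewrite ll. Qed.

Lemma cyl_cat l l' x : cyl l (cyl l' x) = cyl (l ++ l') x.
Proof. by rewrite /cyl foldr_cat. Qed.

Lemma cylset_fix G i x : i \in G -> c i (cylset G x) = cylset G x.
Proof. by move=> iG; apply: cyl_fix; rewrite mem_enum. Qed.

Lemma cylsetU G G' x : cylset G (cylset G' x) = cylset (G :|: G') x.
Proof.
by rewrite /cylset cyl_cat; apply: eq_cyl => i; rewrite mem_cat !mem_enum inE.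
Qed.

Lemma cylset0 x : cylset set0 x = x.
Proof. by rewrite /cylset enum_set0. Qed.

Lemma cylset1 i x : cylset [set i] x = c i x.
Proof. by rewrite /cylset enum_set1. Qed.

Lemma cylset_bot G x : cylset G (x ⊙ ⊖ x) = x ⊙ ⊖ x.
Proof. by apply: cyl_id => i _; apply: (ca_c0 CA). Qed.

Lemma cylset_meet_cylset G x y :
  cylset G (x ⊙ cylset G y) = cylset G x ⊙ cylset G y.
Proof.
rewrite (ba_meetC BA x) {1}/cylset cyl_meet ?(ba_meetC BA (cylset G y)) //.
by move=> i; rewrite mem_enum; apply: cylset_fix.
Qed.

(** * Diagonals *)

(** [tpea_p_p] for p_ij applied to itself exchanges its two indices. *)
Lemma p_sym i j x : p i j x = p j i x.
Proof.
have := tpea_p_p TP i j i j (p i j x).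
by rewrite tpermL tpermR !(tpea_pK TP).
Qed.

Lemma d_top i x : x ≼ d i i.
Proof. by rewrite (ca_d_refl CA i x); apply: le_top. Qed.

(** d_ij is below itself, so p_ij fixes it by [tpea_p_meet_d], whereas
    [tpea_p_d] exchanges its indices. *)
Lemma d_sym i j : d i j = d j i.
Proof.
have <-: d i i ⊙ d i j = d i j.
  by rewrite (ba_meetC BA); apply/(meet_leP BA)/d_top.
rewrite -(tpea_p_meet_d TP) (hom_meet (tpea_p_add TP i j) (tpea_p_neg TP i j)).
rewrite !(tpea_p_d TP) tpermL tpermR (ba_meetC BA).
by apply/(meet_leP BA)/d_top.
Qed.

Lemma c_d i j k : k != i -> k != j -> c k (d i j) = d i j.
Proof. by move=> ki kj; rewrite (ca_d_trans CA ki kj) c_idem. Qed.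

Lemma c_d_top i j x : x ≼ c i (d i j).
Proof.
have [->|ij] := eqVneq i j.
  exact: (le_trans BA (d_top j x) (ca_le_c CA _ _)).
apply: (le_trans BA (d_top j x)); rewrite (ca_d_trans CA ij ij).
exact/c_mono/meet_ler.
Qed.

Lemma d_trans i j k : d i j ⊙ d j k ≼ d i k.
Proof.
have [->|ij] := eqVneq j i; first exact: meet_ler.
have [->|jk] := eqVneq j k; first exact: meet_lel.
by rewrite (ca_d_trans CA ij jk); apply: (ca_le_c CA).
Qed.

(** * Substitution of one coordinate for another *)

(** The guard gives [i/i] its meaning, the identity; c_i (d_ii . x) would be
    c_i x. *)
Definition repl i j x := if i == j then x else c i (d i j ⊙ x).

Lemma replE i j x : i != j -> repl i j x = c i (d i j ⊙ x).
Proof. by rewrite /repl => /negPf->. Qed.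

Lemma repl_add i j x y : repl i j (x ⊕ y) = repl i j x ⊕ repl i j y.
Proof.
rewrite /repl; case: eqP => // _; rewrite (ba_meetDr BA).
exact: (quant_add BA (ca_c0 CA i) (ca_le_c CA i) (ca_c_meet CA i)).
Qed.

Lemma repl_fix i j x : c i x = x -> repl i j x = x.
Proof.
move=> cx; rewrite /repl; case: eqP => // _.
by rewrite (ba_meetC BA) c_meet_fix //; apply/(meet_leP BA)/c_d_top.
Qed.

(** The images of x and -x are disjoint by the last cylindric axiom, and they
    add up to c_i d_ij = 1. *)
Lemma repl_neg i j x : repl i j (⊖ x) = ⊖ repl i j x.
Proof.
have [<-|ij] := eqVneq i j; first by rewrite /repl eqxx.
apply: (neg_unique BA (z := x)); last first.
  rewrite -repl_add repl_fix; first exact: (le_refl BA).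
  exact: (le_anti BA (le_top BA _ _) (ca_le_c CA _ _)).
by rewrite !replE // (ca_d_meet CA _ ij); apply: (le_refl BA).
Qed.

Lemma repl_d i j k l :
  repl i j (d k l) = d (if k == i then j else k) (if l == i then j else l).
Proof.
have [<-|ij] := eqVneq i j.
  by rewrite /repl eqxx; case: eqP => [->|_]; case: eqP => [->|_].
have top x : (forall y, y ≼ x) -> repl i j x = d j j.
  move=> x1; apply: (le_anti BA); first exact: d_top.
  rewrite repl_fix //; apply: (le_anti BA) => //; exact: (ca_le_c CA).
have one m : m != i -> repl i j (d i m) = d j m.
  move=> mi; have [->|mj] := eqVneq m j.
    rewrite replE // meet_idem //; apply: (le_anti BA); first exact: d_top.
    exact: c_d_top.
  by rewrite replE // (d_sym i j) -(ca_d_trans CA) // eq_sym.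
have [->|ki] := eqVneq k i; have [->|li] := eqVneq l i.
- by apply: top => y; apply: d_top.
- exact: one.
- by rewrite d_sym one // d_sym.
- by rewrite repl_fix // c_d // eq_sym.
Qed.

(** * The action of permutations *)

Let p_meet i j := hom_meet (tpea_p_add TP i j) (tpea_p_neg TP i j).

(** Factors r into transpositions one coordinate at a time: r is [i, r i]
    after a permutation that fixes i, and that permutation is factored next. *)
Fixpoint sift (l : seq 'I_n) (r : {perm 'I_n}) x :=
  if l is i :: l' then p i (r i) (sift l' (r * tperm i (r i))%g x) else x.

(** A transposition [i,j] is pushed through the first factor [a, r a] by
    [tpea_p_p].  If neither index is a, this conjugates it.  If one of them is
    a, either it merges with this factor by [tpea_pK] and [tpea_p_refl], or
    [a,j][a,r a] = [a,r a][j,r a] and the inner factor no longer involves a.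
    As r fixes everything outside a :: l, the index r a is then in l. *)
Lemma p_sift l (r : {perm _}) i j x : (forall k, k \notin l -> r k = k) ->
  i \in l -> j \in l -> p i j (sift l r x) = sift l (r * tperm i j)%g x.
Proof.
elim: l r i j x => //= a l IHl r i j x supp.
have [->|ij] := eqVneq i j; first by rewrite tperm1 mulg1 (tpea_p_refl TP).
wlog ja : i j ij / j != a => [wl|].
  have [ja il jl|ja] := eqVneq j a; last exact: wl.
  by rewrite (p_sym i) (tpermC i); apply: wl; rewrite // -?ja // eq_sym.
set r' := (r * tperm a (r a))%g.
have ra_out k : r a = k -> k != a -> k \in l.
  move=> rak ka; apply: contraNT (ka) => kl; apply/eqP/(@perm_inj _ r).
  by rewrite rak supp // inE negb_or ka.
have supp' k : k \notin l -> r' k = k.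
  move=> kl; rewrite permM; have [->|ka] := eqVneq k a; first exact: tpermR.
  rewrite (supp k) ?inE ?negb_or ?ka // tpermD 1?eq_sym //.
  by apply: contraNneq kl => /esym/ra_out->.
rewrite [j \in _]inE (negPf ja) /= => ail jl; rewrite permM.
have [ia|ia] := eqVneq i a; last first.
  move: ail; rewrite inE (negPf ia) /= => il.
  rewrite (tpea_p_p TP) (IHl _ _ _ _ supp' il jl) tpermD //.
  congr (p _ _ (sift l _ x)).
  by rewrite -!mulgA; congr (r * _)%g; rewrite [LHS]conjgC tpermJ tpermD.
rewrite {}ia in ij *.
have [ra|ra] := eqVneq (r a) a.
  by rewrite /r' ra tpermL tperm1 mulg1 (tpea_p_refl TP) -mulgA tperm2 mulg1.
have [rj|rj] := eqVneq (r a) j.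
  by rewrite /r' rj tpermR tperm1 mulg1 (tpea_p_refl TP) (tpea_pK TP).
have rl : r a \in l by apply: ra_out.
rewrite (tpermD (z := r a)) 1?[_ == r a]eq_sym //.
have -> y : p a j (p a (r a) y) = p a (r a) (p j (r a) y).
  by rewrite [RHS](tpea_p_p TP) tpermR (tpermD (z := j)) ?[p j a _]p_sym.
rewrite (IHl _ _ _ _ supp' jl rl); congr (p _ _ (sift l _ x)).
rewrite /r' -!mulgA; congr (r * _)%g.
by rewrite [RHS]conjgC tpermJ tpermL (tpermD (z := j)) // (tpermC j).
Qed.

Definition pact (r : {perm 'I_n}) x := sift (enum 'I_n) r x.

Lemma p_pact r i j x : p i j (pact r x) = pact (r * tperm i j)%g x.
Proof. by apply: p_sift => [k||]; rewrite mem_enum. Qed.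

Lemma pact1 x : pact 1%g x = x.
Proof.
rewrite /pact; elim: (enum _) => //= i l IHl.
by rewrite perm1 tperm1 mulg1 IHl (tpea_p_refl TP).
Qed.

Lemma pactM r t x : pact (r * t)%g x = pact t (pact r x).
Proof.
elim/perm_tperm_ind: t => [|t i j IHt]; first by rewrite mulg1 pact1.
by rewrite mulgA -!p_pact IHt.
Qed.

Lemma pact_meet r x y : pact r (x ⊙ y) = pact r x ⊙ pact r y.
Proof.
elim/perm_tperm_ind: r => [|r i j IHr]; first by rewrite !pact1.
by rewrite -!p_pact IHr p_meet.
Qed.

Lemma pact_mono r x y : x ≼ y -> pact r x ≼ pact r y.
Proof.
move=> /(meet_leP BA) xy; apply/(meet_leP BA).
by rewrite -pact_meet xy.
Qed.

Lemma pact_d r i j : pact r (d i j) = d (r i) (r j).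
Proof.
elim/perm_tperm_ind: r => [|r a b IHr]; first by rewrite pact1 !perm1.
by rewrite -p_pact IHr (tpea_p_d TP) !permM.
Qed.

Lemma pact_cyl r l x : pact r (cyl l x) = cyl (map r l) (pact r x).
Proof.
elim/perm_tperm_ind: r => [|r a b IHr].
  rewrite !pact1; congr cyl; rewrite -[LHS]map_id.
  by apply: eq_map => i; rewrite perm1.
rewrite -!p_pact IHr; elim: l {IHr} => //= i l IHl.
by rewrite (tpea_p_c TP) IHl permM.
Qed.

Lemma pact_cylset r G x : pact r (cylset G x) = cylset (r @: G) (pact r x).
Proof.
rewrite pact_cyl; apply: eq_cyl => i; rewrite mem_enum.
by apply/mapP/imsetP => -[k kG ->]; exists k; rewrite ?mem_enum // -mem_enum.
Qed.

Lemma p_cylset i j G x : p i j (cylset G x) = cylset (tperm i j @: G) (p i j x).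
Proof.
have pE y : p i j y = pact (tperm i j) y by rewrite -[y in LHS]pact1 p_pact mul1g.
by rewrite !pE pact_cylset.
Qed.

(** On x cylindrified in j, the element c_i (d_ij . x) equals
    p_ij (c_j (d_ij . x)) because p_ij fixes d_ij . x, and c_j (d_ij . x) = x. *)
Lemma repl_p i j x : c j x = x -> repl i j x = p i j x.
Proof.
have [<-|ij] := eqVneq i j; first by rewrite /repl eqxx (tpea_p_refl TP).
move=> cx; rewrite replE //; set y := _ ⊙ _.
have py : p i j y = y by rewrite /y (ba_meetC BA) (tpea_p_meet_d TP).
rewrite -{1}py -{1}(tpermR i j) -(tpea_p_c TP); congr p.
rewrite /y (ba_meetC BA) c_meet_fix //; apply/(meet_leP BA).
by rewrite d_sym; apply: c_d_top.
Qed.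

(** If c_i x = x then the replacement [i/j] fixes x; if c_j x = x then it acts
    as the transposition. *)
Lemma p_fix i j x : c i x = x -> c j x = x -> p i j x = x.
Proof. by move=> cix cjx; rewrite -repl_p // repl_fix. Qed.

(** * Words of operations and their normal form *)

Definition gen_op (g : gen n) x :=
  match g with inl ij => p ij.1 ij.2 x | inr ij => repl ij.1 ij.2 x end.

Definition word_op (w : seq (gen n)) x := foldr gen_op x w.

Lemma word_op_cat w w' x : word_op (w ++ w') x = word_op w (word_op w' x).
Proof. by rewrite /word_op foldr_cat. Qed.

Lemma word_op_add w x y : word_op w (x ⊕ y) = word_op w x ⊕ word_op w y.
Proof.
elim: w => //= -[] [i j] w -> /=; [exact: tpea_p_add TP _ _ _ _|exact: repl_add].
Qed.

Lemma word_op_neg w x : word_op w (⊖ x) = ⊖ word_op w x.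
Proof.
elim: w => //= -[] [i j] w -> /=; [exact: tpea_p_neg TP _ _ _|exact: repl_neg].
Qed.

Lemma word_op_d w i j : word_op w (d i j) = d (word_fun w i) (word_fun w j).
Proof.
elim: w => //= -[] [a b] w -> /=; [exact: tpea_p_d TP _ _ _ _|exact: repl_d].
Qed.

Implicit Type t : 'I_n -> 'I_n.

(** x . D_t, where D_t says that coordinates in one kernel class of t agree.
    Folding from x avoids naming the Boolean unit. *)
Definition ker_meet t x :=
  foldr (fun ij => meet add neg (d ij.1 ij.2)) x
        [seq ij <- enum {: 'I_n * 'I_n} | t ij.1 == t ij.2].

Lemma ker_meet_le t x : ker_meet t x ≼ x.
Proof.
rewrite /ker_meet; elim: [seq _ <- _ | _] => [|ij l IHl] /=.
  exact: (le_refl BA).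
exact: (le_trans BA (meet_ler BA _ _) IHl).
Qed.

Lemma ker_meet_le_d t x i j : t i = t j -> ker_meet t x ≼ d i j.
Proof.
move=> tij; rewrite /ker_meet; set l := [seq _ <- _ | _].
have: (i, j) \in l by rewrite mem_filter /= tij eqxx mem_enum.
elim: l => //= ij l IHl; rewrite inE => /predU1P[<-|/IHl].
  exact: (meet_lel BA).
exact: (le_trans BA (meet_ler BA _ _)).
Qed.

Lemma le_ker_meet t x y :
  y ≼ x -> (forall i j, t i = t j -> y ≼ d i j) -> y ≼ ker_meet t x.
Proof.
move=> yx yd; rewrite /ker_meet.
have: all (fun ij => t ij.1 == t ij.2)
          [seq ij <- enum {: 'I_n * 'I_n} | t ij.1 == t ij.2].
  exact: filter_all.
elim: [seq _ <- _ | _] => //= ij l IHl /andP[/eqP tij /IHl].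
by apply: (le_meet BA); apply: yd.
Qed.

(** A coordinate alone in its kernel class does not occur in D_t. *)
Lemma cyl_ker_meet l t x : (forall i j, i \in l -> t i = t j -> i = j) ->
  cyl l (ker_meet t x) = ker_meet t (cyl l x).
Proof.
move=> l_free; rewrite /ker_meet.
have: all (fun ij => t ij.1 == t ij.2)
          [seq ij <- enum {: 'I_n * 'I_n} | t ij.1 == t ij.2].
  exact: filter_all.
elim: [seq _ <- _ | _] => //= -[a b] s IHs /andP[/= /eqP tab /IHs <-].
apply: cyl_meet => i il; have [<-|ab] := eqVneq a b.
  by apply: (le_anti BA); [exact: d_top | exact: (ca_le_c CA)].
rewrite c_d //; apply: contraNneq ab => iE; apply/eqP.
  by rewrite -iE; apply: l_free; rewrite // iE.
by rewrite -iE; apply/esym/l_free; rewrite // iE.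
Qed.

Definition miss t : {set 'I_n} := [set k | k \notin codom t].

Lemma missP t k : reflect (exists i, k = t i) (k \notin miss t).
Proof. by rewrite inE negbK; apply: codomP. Qed.

(** On the image of t, the permutation r^-1 picks preimages under t. *)
Definition perm_section t (r : {perm 'I_n}) := forall i, t ((r^-1)%g (t i)) = t i.

(** This is independence of the normal form from the permutation, moved to the
    case where t is a retraction.  Induction on the support of r.  If r^-1 moves
    some k in the image to m0, then t identifies m0 and k, so the transposition
    [m0,k] fixes z and may be applied before r; the composite fixes k.
    Otherwise r moves only coordinates missed by t, and transpositions of
    these are absorbed by the outer cylindrification. *)
Lemma cylset_pact_retract t (r : {perm 'I_n}) z :
    (forall i, t (t i) = t i) -> (forall i j, t i = t j -> z ≼ d i j) ->
    perm_section t r ->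
  cylset (miss t) (pact r z) = cylset (miss t) z.
Proof.
move=> tt zd; have [m] := ubnP #|[set k | r k != k]|.
elim: m r => // m IHm r; rewrite ltnS => le_m tr.
have shrink (r' : {perm 'I_n}) k : r k != k -> r' k = k ->
    (forall i, r i = i -> r' i = i) -> perm_section t r' ->
    cylset (miss t) (pact r' z) = cylset (miss t) z.
  move=> rk r'k sub; apply: IHm; apply: leq_trans le_m.
  apply/proper_card/properP; split; last by exists k; rewrite inE ?rk ?r'k ?eqxx.
  by apply/subsetP => i; rewrite !inE; apply: contra => /eqP/sub->.
have [/existsP[k /andP[kI rk]]|/existsPn fixI] :=
    boolP [exists k, (k \notin miss t) && (r k != k)].
  pose m0 := (r^-1)%g k.
  have rm : r m0 = k by rewrite /m0 permKV.
  have mk : m0 != k by apply: contraNneq rk => mk; rewrite -{1}mk rm.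
  have tk : t k = k by case/missP: kI => i ->.
  have tm : t m0 = k by case/missP: (kI) => i ki; rewrite /m0 ki tr.
  have zp : p m0 k z = z.
    have /(meet_leP BA) <- : z ≼ d m0 k by apply: zd; rewrite tm.
    exact: (tpea_p_meet_d TP).
  have tsw i : t (tperm m0 k i) = t i.
    by case: tpermP => [->|->|]; rewrite ?tm ?tk.
  rewrite -{1}zp -[z in p _ _ z]pact1 p_pact mul1g -pactM.
  apply: (shrink _ k) => // [|i ri|i].
  - by rewrite permM tpermR.
  - rewrite permM tpermD //.
      by apply: contraNneq mk => m0i; rewrite -[X in _ == X]rm m0i ri.
    by apply: contraNneq rk => ->; rewrite ri.
  - by rewrite invMg permM tpermV tsw tr.
have [/existsP[k rk]|/existsPn r1] := boolP [exists k, r k != k]; last first.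
  suff -> : r = 1%g by rewrite pact1.
  by apply/permP => k; rewrite perm1; apply/eqP; move: (r1 k); rewrite negbK.
have inN k' : r k' != k' -> k' \in miss t.
  by move=> rk'; move: (fixI k'); rewrite rk' andbT negbK.
have kN := inN _ rk; have rkN : r k \in miss t.
  by apply: inN; rewrite (inj_eq perm_inj).
rewrite -[r](mulgK (tperm k (r k))) tpermV -p_pact.
have <-: cylset (miss t) (pact (r * tperm k (r k))%g z) = cylset (miss t) z.
  have fix_r' i : r i = i -> (r * tperm k (r k))%g i = i.
    move=> ri; rewrite permM ri tpermD //.
      by apply: contraNneq rk => ->; rewrite ri.
    by apply: contraNneq rk => rki; rewrite -(inj_eq (@perm_inj _ r)) rki ri.
  apply: (shrink _ k) => //; first by rewrite permM tpermR.
  move=> i; have rti : r (t i) = t i.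
    have tiI : t i \notin miss t by apply/missP; exists i.
    by apply/eqP; move: (fixI (t i)); rewrite tiI negbK.
  have /(canRL (permK _)) <- : (r * tperm k (r k))%g (t i) = t i by apply: fix_r'.
  by rewrite tt.
rewrite -[RHS](p_fix (i := k) (j := r k)) ?cylset_fix // p_cylset.
congr (cylset _ _); apply/setP => i.
apply/idP/imsetP => [iN|[a aN ->]]; last by case: tpermP.
by exists (tperm k (r k) i); rewrite ?tpermK //; case: tpermP.
Qed.

Definition normal_form t r x := cylset (miss t) (pact r (ker_meet t x)).

Definition has_normal_form t (f : A -> A) :=
  exists2 r, perm_section t r & forall x, f x = normal_form t r x.

(** With v = t o r^-1, a retraction onto the image of t, passing from r to r'
    means applying r' o r^-1, to which [cylset_pact_retract] applies. *)
Lemma normal_form_unique t f g x :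
  has_normal_form t f -> has_normal_form t g -> f x = g x.
Proof.
move=> [r tr fE] [r' tr' gE]; rewrite {}fE {}gE /normal_form.
pose v i := t ((r^-1)%g i).
have vr i : v (r i) = t i by rewrite /v permK.
have <-: miss v = miss t.
  apply/setP => k; rewrite !inE; congr (~~ _); apply/codomP/codomP => -[i ->].
    by exists ((r^-1)%g i).
  by exists (r i).
have -> y : pact r' y = pact (r^-1 * r')%g (pact r y) by rewrite -pactM mulKVg.
apply/esym/cylset_pact_retract => [i|i j vij|i].
- by rewrite /v tr.
- rewrite -[i](permKV r) -[j](permKV r) -pact_d.
  exact/pact_mono/ker_meet_le_d.
- by rewrite invMg invgK permM vr /v tr'.
Qed.

Lemma has_normal_form_id : has_normal_form id id.
Proof.
exists 1%g => [i|x]; rewrite /normal_form ?invg1 ?perm1 //.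
have -> : miss id = set0 by apply/setP => k; rewrite !inE codom_f.
rewrite cylset0 pact1; apply: (le_anti BA); last exact: ker_meet_le.
by apply: le_ker_meet => [|i j ->]; [exact: (le_refl BA) | exact: d_top].
Qed.

Lemma has_normal_form_p t f i j : has_normal_form t f ->
  has_normal_form (fun k => tperm i j (t k)) (fun x => p i j (f x)).
Proof.
move=> [r tr fE]; exists (r * tperm i j)%g => [k|x].
  by rewrite invMg permM tpermV tpermK tr.
rewrite fE /normal_form p_cylset p_pact; congr (cylset _ (pact _ _)).
  apply/setP => k; rewrite -{1}(tpermK i j k) mem_imset ?inE; last exact: perm_inj.
  congr (~~ _); apply/codomP/codomP => -[a E]; exists a; last by rewrite E tpermK.
  by rewrite -E tpermK.
apply: (le_anti BA); apply: le_ker_meet => [|a b ab].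
- exact: ker_meet_le.
- by apply: ker_meet_le_d; apply: perm_inj ab.
- exact: ker_meet_le.
- by apply: ker_meet_le_d; rewrite ab.
Qed.

(** If i is not in the image of t, nothing changes: the normal form is already
    cylindrified in i.  If i is in the image and j is not, then [i/j] o t equals
    [i,j] o t and the operation is p_ij on an element cylindrified in j.  If both
    are in the image, the kernel classes over i and j merge, which multiplies D_t
    by one diagonal element, and i leaves the image. *)
Lemma has_normal_form_repl t f i j : has_normal_form t f ->
  has_normal_form (fun k => if t k == i then j else t k) (fun x => repl i j (f x)).
Proof.
have [<- ft|ij tf] := eqVneq i j.
  rewrite [fun k => _](_ : _ = t) /repl ?eqxx //.
  by apply: functional_extensionality => k; case: eqP.
have [i_out|iI] := boolP (i \in miss t).
  rewrite [fun k => _](_ : _ = t); last first.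
    apply: functional_extensionality => k; case: eqP => // tk.
    by move: i_out; rewrite inE -tk codom_f.
  case: tf => r tr fE; exists r => // x.
  by rewrite fE /normal_form repl_fix // cylset_fix.
have [j_out|jI] := boolP (j \in miss t).
  rewrite [fun k => _](_ : _ = fun k => tperm i j (t k)); last first.
    apply: functional_extensionality => k.
    case: tpermP => [->|tk|]; rewrite ?eqxx //.
      by move: j_out; rewrite inE -tk codom_f.
    by move=> /eqP/negPf->.
  have [r tr E] := has_normal_form_p i j tf; exists r => // x.
  by rewrite -E repl_p //; case: tf => r' _ ->; rewrite /normal_form cylset_fix.
have [[a ta] [b tb]] : (exists a, i = t a) /\ (exists b, j = t b).
  by split; apply/missP.
case: tf => r tr fE; set t' := fun k => _.
have ker_i k : t k = i -> t' k = j by rewrite /t' => ->; rewrite eqxx.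
have ker_n k : t k != i -> t' k = t k by rewrite /t' => /negPf->.
exists r => [k|x].
  have [tk|tk] := eqVneq (t k) i.
    by rewrite (ker_i k) // ker_n tb tr // -tb eq_sym.
  by rewrite (ker_n k) // ker_n ?tr.
rewrite fE /normal_form replE //.
have -> : cylset (miss t') = cylset (i |: miss t).
  congr cylset; apply/setP => k; rewrite !inE.
  have [->|ki] /= := eqVneq k i.
    apply/codomP => -[m im]; have [tm|tm] := eqVneq (t m) i.
      by case/eqP: ij; rewrite im ker_i.
    by case/eqP: (tm); rewrite -ker_n.
  congr (~~ _); apply/codomP/codomP => -[m km]; last first.
    by exists m; rewrite ker_n -?km.
  have [tm|tm] := eqVneq (t m) i; first by exists b; rewrite km ker_i.
  by exists m; rewrite km ker_n.
rewrite -cylsetU cylset1 -/(cylset _ _); congr c.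
pose i0 := (r^-1)%g i; pose j0 := (r^-1)%g j.
have ti0 : t i0 = i by rewrite /i0 ta tr.
have tj0 : t j0 = j by rewrite /j0 tb tr.
have -> : ker_meet t' x = d i0 j0 ⊙ ker_meet t x.
  apply: (le_anti BA).
    apply: (le_meet BA).
      by apply: ker_meet_le_d; rewrite ker_i // ker_n tj0 // eq_sym.
    apply: le_ker_meet => [|k l kl]; first exact: ker_meet_le.
    by apply: ker_meet_le_d; rewrite /t' kl.
  apply: le_ker_meet => [|k l].
    exact: (le_trans BA (meet_ler BA _ _) (ker_meet_le _ _)).
  have le_d u v : t u = t v -> d i0 j0 ⊙ ker_meet t x ≼ d u v.
    by move=> uv; apply: (le_trans BA (meet_ler BA _ _)); apply: ker_meet_le_d.
  have merge u v : t u = i -> t v = j -> d i0 j0 ⊙ ker_meet t x ≼ d u v.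
    move=> tu tv; apply: (le_trans BA _ (d_trans u j0 v)); apply: (le_meet BA).
      apply: (le_trans BA _ (d_trans u i0 j0)); apply: (le_meet BA).
        by apply: le_d; rewrite ti0.
      exact: (meet_lel BA).
    by apply: le_d; rewrite tj0.
  have [tk|tk] := eqVneq (t k) i; have [tl|tl] := eqVneq (t l) i.
  - by move=> _; apply: le_d; rewrite tk.
  - by rewrite (ker_i k) // (ker_n l) // => jl; apply: merge.
  - by rewrite (ker_n k) // (ker_i l) // => kj; rewrite (d_sym k); apply: merge.
  - by rewrite !ker_n //; apply: le_d.
rewrite pact_meet pact_d !permKV /cylset cyl_meet // => k; rewrite mem_enum => kN.
by rewrite c_d //; apply: contraTneq kN => ->.
Qed.

Lemma word_op_normal_form w : has_normal_form (word_fun w) (word_op w).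
Proof.
elim: w => [|[[i j]|[i j]] w IHw] /=; first exact: has_normal_form_id.
  exact: has_normal_form_p.
exact: has_normal_form_repl.
Qed.

Lemma eq_word_op w w' x : word_fun w =1 word_fun w' -> word_op w x = word_op w' x.
Proof.
move=> /functional_extensionality ww'; have := word_op_normal_form w.
rewrite ww' => nf_w; exact: (normal_form_unique x nf_w (word_op_normal_form w')).
Qed.

(** Precomposing with [i/j] for some j != i makes the two transformations equal,
    and c_i x absorbs this replacement. *)
Lemma word_op_c w w' i x : {in ~: [set i], word_fun w =1 word_fun w'} ->
  word_op w (c i x) = word_op w' (c i x).
Proof.
move=> ww'; have [/existsP[j ji]|/existsPn only_i] := boolP [exists j, j != i].
  have cE : c i x = word_op [:: inr (i, j)] (c i x) by rewrite /= repl_fix.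
  rewrite cE -!word_op_cat; apply: eq_word_op => k; rewrite !word_fun_cat.
  by apply: ww' => /=; have [_|ki] := eqVneq k i; rewrite !inE.
(* There is only one coordinate, hence only one transformation. *)
apply: eq_word_op => k; suff all_eq l : l = i by rewrite [LHS]all_eq [RHS]all_eq.
by apply/eqP; move: (only_i l); rewrite negbK.
Qed.

(** Changes the values of one transformation into those of the other, one
    coordinate of G at a time. *)
Lemma word_op_cylset w w' G x : {in ~: G, word_fun w =1 word_fun w'} ->
  word_op w (cylset G x) = word_op w' (cylset G x).
Proof.
suff step (l : seq 'I_n) w1 : {subset l <= G} ->
    (forall k, k \notin l -> word_fun w1 k = word_fun w' k) ->
    word_op w1 (cylset G x) = word_op w' (cylset G x).
  move=> ww'; apply: (step (enum G)) => k; rewrite mem_enum // => kG.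
  by apply: ww'; rewrite inE.
elim: l w1 => [|i l IHl] w1 lG agree; first by apply: eq_word_op => k; apply: agree.
pose t k := if k == i then word_fun w' i else word_fun w1 k.
have [w2 w2E] := word_fun_surj t.
rewrite -(cylset_fix x (lG i (mem_head _ _))) (@word_op_c w1 w2).
  rewrite cylset_fix ?lG ?mem_head //; apply: IHl => k kl.
    by apply: lG; rewrite inE kl orbT.
  rewrite w2E /t; case: eqP => [->//|/eqP ki].
  by apply: agree; rewrite inE negb_or ki.
by move=> k; rewrite !inE w2E /t => /negPf->.
Qed.

(** Since the transformation is injective on G', the classes met by G' are
    singletons: c_(G') commutes with the kernel product, the permutation of the
    normal form agrees with the transformation on G', and both sides are
    cylindrified along G together with the coordinates outside the image. *)
Lemma cylset_word_op w G G' x :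
    G' = word_fun w @^-1: G -> {in G' &, injective (word_fun w)} ->
  cylset G (word_op w x) = word_op w (cylset G' x).
Proof.
have [r tr fE] := word_op_normal_form w; rewrite !{}fE /normal_form.
move: (word_fun w) tr => t tr GE t_inj.
have -> : ker_meet t (cylset G' x) = cylset G' (ker_meet t x).
  apply/esym/cyl_ker_meet => i j; rewrite mem_enum => iG tij; apply: t_inj => //.
  by move: iG; rewrite GE !inE tij.
rewrite pact_cylset !cylsetU; congr (cylset _ _); apply/setP => i; rewrite !inE.
have [/codomP[k ->]|_] /= := boolP (i \in codom t); last by rewrite orbT.
rewrite orbF.
have rk l : l \in G' -> r l = t l.
  move=> lG; rewrite -[RHS](permKV r); congr (r _); apply: t_inj => //.
  by move: lG; rewrite GE !inE tr.
apply/idP/imsetP => [kG|[l lG ->]]; last first.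
  by rewrite rk //; move: lG; rewrite GE inE.
have kG' : k \in G' by rewrite GE inE.
by exists k; rewrite ?rk.
Qed.

Theorem tpea_pea :
  pea_axioms add neg cylset (fun t : {ffun 'I_n -> 'I_n} => word_op (word_of t)) d.
Proof.
split=> //.
- exact: cylset_bot.
- by move=> G x; apply: le_cyl.
- exact: cylset_meet_cylset.
- exact: cylset0.
- exact: cylsetU.
- by move=> t x y; apply: word_op_add.
- by move=> t x; apply: word_op_neg.
- by move=> x; apply: (@eq_word_op _ [::]) => k; rewrite word_ofE ffunE.
- move=> r t x; rewrite -word_op_cat; apply: eq_word_op => k.
  by rewrite word_fun_cat !word_ofE ffunE.
- by move=> G r t x rt; apply: word_op_cylset => k kG; rewrite !word_ofE rt.
- move=> G G' t x GE t_inj; apply: cylset_word_op => [|k l kG lG].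
    by rewrite GE; apply/setP => k; rewrite !inE word_ofE.
  by rewrite !word_ofE; apply: t_inj.
- exact: (ca_d_refl CA).
- move=> i j x; rewrite (@eq_word_op _ [:: inr (i, j)]); last first.
    by move=> k; rewrite word_ofE ffunE.
  rewrite /= /repl (ba_meetC BA); case: eqP => [_|_]; first exact: (meet_ler BA).
  exact: (ca_le_c CA).
- by move=> t i j; rewrite word_op_d !word_ofE.
Qed.

End Transpositional.

(** * From polyadic operations to transpositions *)

Section Polyadic.
Variables (A : Type) (add : A -> A -> A) (neg : A -> A) (n : nat).
Variables (c : {set 'I_n} -> A -> A) (s : {ffun 'I_n -> 'I_n} -> A -> A).
Variable d : 'I_n -> 'I_n -> A.
Hypothesis PE : pea_axioms add neg c s d.
Implicit Types (x y z : A) (i j k : 'I_n) (G : {set 'I_n}).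

Local Notation "x ⊕ y" := (add x y) (at level 50, left associativity).
Local Notation "x ⊙ y" := (meet add neg x y) (at level 40, left associativity).
Local Notation "⊖ x" := (neg x) (at level 35, right associativity).
Local Notation "x ≼ y" := (le add x y) (at level 70, no associativity).

Let BA := pea_boolean PE.
Let s_meet t := hom_meet (pea_s_add PE t) (pea_s_neg PE t).
Let s_mono t := hom_mono (pea_s_add PE t).

Definition cyl1 i x := c [set i] x.
Definition swap i j x := s [ffun k => tperm i j k] x.

Local Notation replace i j := [ffun k => if k == i then j else k].

(** The substitution [i/j] fixes what is cylindrified in i, its values are
    cylindrified in i since i has no preimage, and it sends d_ij to 1; so s_[i/j] x
    lies both above and below c_i (d_ij . x). *)
Lemma pea_replace i j x : s (replace i j) x = repl add neg cyl1 d i j x.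
Proof.
rewrite /repl; case: eqP => [<-|/eqP ij].
  rewrite -[RHS](pea_s_id PE); congr (s _ _); apply/ffunP => k; rewrite !ffunE.
  by case: eqP.
set t := replace i j.
have fix_c y : s t (cyl1 i y) = cyl1 i y.
  rewrite -[RHS](pea_s_id PE); apply: (pea_s_c PE) => k.
  by rewrite !inE !ffunE => /negPf->.
have c_fix y : cyl1 i (s t y) = s t y.
  rewrite /cyl1 (pea_c_s PE (D := set0)) ?(pea_c_set0 PE) //.
    apply/setP => k; rewrite !inE ffunE.
    by have [_|/negPf->] := eqVneq k i; rewrite // eq_sym (negPf ij).
  by move=> k; rewrite inE.
apply: (le_anti BA).
  have <-: s t (d i j ⊙ x) = s t x.
    rewrite s_meet (pea_s_d PE) !ffunE eqxx eq_sym (negPf ij) (pea_d_refl PE j (s t x)).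
    by rewrite (ba_meetC BA) (ba_meet1 BA).
  by rewrite -fix_c; apply: s_mono; apply: (pea_le_c PE).
rewrite -c_fix; apply: (quant_mono BA (pea_le_c PE _) (pea_c_meet PE _)).
by rewrite (ba_meetC BA); apply: (pea_meet_d_le PE).
Qed.

(** For y below d_ij, the element y . -p_ij y is below its image under [i/j].
    This image vanishes because [i/j] o [i,j] = [i/j]; hence y is below p_ij y,
    and then they are equal as p_ij is an involution. *)
Lemma swap_meet_d i j x : swap i j (x ⊙ d i j) = x ⊙ d i j.
Proof.
have swapK y : swap i j (swap i j y) = y.
  rewrite /swap -(pea_s_comp PE) -[RHS](pea_s_id PE); congr (s _ _).
  by apply/ffunP => k; rewrite !ffunE tpermK.
set y := x ⊙ d i j; suff le_swap: y ≼ swap i j y.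
  apply: (le_anti BA) => //.
  by rewrite -[X in _ ≼ X]swapK; apply: s_mono.
have absorb : s (replace i j) (swap i j y) = s (replace i j) y.
  rewrite /swap -(pea_s_comp PE); congr (s _ _); apply/ffunP => k; rewrite !ffunE.
  by case: tpermP => [->|->|_ //]; rewrite !eqxx // if_same.
apply: (le_disj BA (z := s (replace i j) y)).
rewrite -{2}absorb -(pea_s_neg PE) -s_meet.
have yd : y ⊙ ⊖ swap i j y ≼ (y ⊙ ⊖ swap i j y) ⊙ d i j.
  apply: (le_meet BA (le_refl BA _)).
  exact: (le_trans BA (meet_lel BA _ _) (meet_ler BA _ _)).
exact: (le_trans BA yd (pea_meet_d_le PE _ _ _)).
Qed.

Theorem pea_tpea : tpea_axioms add neg cyl1 d swap.
Proof.
have s_ext (t t' : {ffun 'I_n -> 'I_n}) x : t =1 t' -> s t x = s t' x.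
  by move=> tt; congr (s _ _); apply/ffunP.
split.
  split=> //.
  - by move=> i x; apply: (pea_c0 PE).
  - by move=> i x; apply: (pea_le_c PE).
  - by move=> i x y; apply: (pea_c_meet PE).
  - by move=> i j x; rewrite /cyl1 !(pea_c_setU PE) setUC.
  - by move=> i x; apply: (pea_d_refl PE).
  - move=> i j k ki kj; rewrite (ba_meetC BA).
    have := pea_replace k j (d i k); rewrite (replE _ _ _ _ _ kj) => <-.
    by rewrite (pea_s_d PE) !ffunE eqxx eq_sym (negPf ki).
  - move=> i j x ij; rewrite -!(replE _ _ _ _ _ ij) -!pea_replace (pea_s_neg PE).
    exact: (bot_eq BA).
- by move=> i j x y; apply: (pea_s_add PE).
- by move=> i j x; apply: (pea_s_neg PE).
- move=> i j k x; rewrite /swap /cyl1; apply/esym/(pea_c_s PE) => [|a b aD bD].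
    by apply/setP => l; rewrite !inE ffunE (inj_eq perm_inj).
  by rewrite !ffunE => /perm_inj.
- by move=> i j k l; rewrite /swap (pea_s_d PE) !ffunE.
- move=> i j k l x; rewrite /swap -!(pea_s_comp PE); apply: s_ext => a.
  by rewrite !ffunE; apply: inj_tperm; apply: perm_inj.
- move=> i j x; rewrite /swap -(pea_s_comp PE) -[RHS](pea_s_id PE); apply: s_ext => a.
  by rewrite !ffunE tpermK.
- move=> i x; rewrite -[RHS](pea_s_id PE); apply: s_ext => a.
  by rewrite !ffunE tperm1 perm1.
- exact: swap_meet_d.
Qed.

Lemma pea_cylset G x : cylset cyl1 G x = c G x.
Proof.
rewrite /cylset -[in RHS](set_enum G); elim: (enum G) => [|i l IHl] /=.
  by rewrite set_nil (pea_c_set0 PE).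
by rewrite IHl /cyl1 (pea_c_setU PE) set_cons.
Qed.

Lemma pea_word_op w x (t : {ffun 'I_n -> 'I_n}) :
  word_fun w =1 t -> word_op add neg cyl1 d swap w x = s t x.
Proof.
move=> wt; have {t wt}-> : t = [ffun k => word_fun w k].
  by apply/ffunP => k; rewrite ffunE wt.
elim: w => [|g w IHw] /=; first by rewrite -[LHS](pea_s_id PE).
rewrite /word_op /= -/(word_op _ _ _ _ _ _ _) {}IHw.
case: g => -[i j] /=; rewrite -?pea_replace ?/swap -(pea_s_comp PE).
  by congr (s _ _); apply/ffunP => k; rewrite !ffunE.
by congr (s _ _); apply/ffunP => k; rewrite !ffunE.
Qed.

End Polyadic.

(** * Term-definitional equivalence *)

(** Terms form an algebra on which [eval v] is a homomorphism, so an operation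
    constructed in every algebra yields, on variables, a term defining it. *)
Definition term_algebra (S : signature) (m : nat) : algebra S :=
  @Algebra S (term S m) (fun o ts => App o (tnth ts)).

Lemma eval_term_op (S : signature) (A : algebra S) m (v : m.-tuple A) o
    (ts : (arity o).-tuple (term S m)) :
  eval v (op (term_algebra S m) o ts) = op A o (map_tuple (eval v) ts).
Proof.
by congr (op A o _); apply: eq_from_tnth => i; rewrite tnth_mktuple tnth_map.
Qed.

Lemma map_tuple1 (T U : Type) (f : T -> U) x : map_tuple f [tuple x] = [tuple f x].
Proof. exact: val_inj. Qed.

Lemma map_tuple2 (T U : Type) (f : T -> U) x y :
  map_tuple f [tuple x; y] = [tuple f x; f y].
Proof. exact: val_inj. Qed.

Lemma tuple0_eta (T : Type) (v : 0.-tuple T) : [tuple] = v.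
Proof. exact/esym/tuple0. Qed.

Lemma tuple1_eta (T : Type) (v : 1.-tuple T) : [tuple tnth v ord0] = v.
Proof. by apply: eq_from_tnth => i; rewrite (ord1 i). Qed.

Lemma tuple2_eta (T : Type) (v : 2.-tuple T) :
  [tuple tnth v ord0; tnth v ord_max] = v.
Proof.
apply: eq_from_tnth => i; rewrite (tnth_nth (tnth v ord0)).
by case: i => [[|[|//]] lt_i]; congr (tnth v _); apply: val_inj.
Qed.

(* Simplification would otherwise evaluate through the term algebra. *)
#[local] Arguments eval : simpl never.

Section Interpretations.
Variable n : nat.

Section TranspositionalOperations.
Variable A : algebra (tpea_signature n).
Definition tpea_add x y := op A TAdd [tuple x; y].
Definition tpea_neg x := op A TNeg [tuple x].
Definition tpea_cyl i x := op A (TCyl i) [tuple x].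
Definition tpea_diag i j := op A (TDiag i j) [tuple].
Definition tpea_perm i j x := op A (TPerm i j) [tuple x].
Definition tpea_word :=
  word_op tpea_add tpea_neg tpea_cyl tpea_diag tpea_perm.
End TranspositionalOperations.

Section PolyadicOperations.
Variable B : algebra (pea_signature n).
Definition pea_add x y := op B PAdd [tuple x; y].
Definition pea_neg x := op B PNeg [tuple x].
Definition pea_cyl G x := op B (PCyl G) [tuple x].
Definition pea_subst t x := op B (PSubst t) [tuple x].
Definition pea_diag i j := op B (PDiag i j) [tuple].
End PolyadicOperations.

Definition pea_in_tpea : interpretation (tpea_signature n) (pea_signature n) :=
  fun o : pea_symbol n =>
    let T m := term_algebra (tpea_signature n) m in
    match o return term (tpea_signature n) (@arity (pea_signature n) o) with
    | PAdd => @tpea_add (T 2) (Var ord0) (Var ord_max)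
    | PNeg => @tpea_neg (T 1) (Var ord0)
    | PCyl G => cylset (@tpea_cyl (T 1)) G (Var ord0)
    | PSubst t => @tpea_word (T 1) (word_of t) (Var ord0)
    | PDiag i j => @tpea_diag (T 0) i j
    end.

Definition tpea_in_pea : interpretation (pea_signature n) (tpea_signature n) :=
  fun o : tpea_symbol n =>
    let T m := term_algebra (pea_signature n) m in
    match o return term (pea_signature n) (@arity (tpea_signature n) o) with
    | TAdd => @pea_add (T 2) (Var ord0) (Var ord_max)
    | TNeg => @pea_neg (T 1) (Var ord0)
    | TCyl i => cyl1 (@pea_cyl (T 1)) i (Var ord0)
    | TDiag i j => @pea_diag (T 0) i j
    | TPerm i j => swap (@pea_subst (T 1)) i j (Var ord0)
    end.

Section EvalTranspositional.
Variables (A : algebra (tpea_signature n)) (m : nat) (v : m.-tuple A).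
Local Notation T := (term_algebra (tpea_signature n) m).
Implicit Types u w : T.

Lemma eval_tpea_add u w : eval v (tpea_add u w) = tpea_add (eval v u) (eval v w).
Proof. by rewrite /tpea_add eval_term_op map_tuple2. Qed.

Lemma eval_tpea_neg u : eval v (tpea_neg u) = tpea_neg (eval v u).
Proof. by rewrite /tpea_neg eval_term_op map_tuple1. Qed.

Lemma eval_tpea_cyl i u : eval v (tpea_cyl i u) = tpea_cyl i (eval v u).
Proof. by rewrite /tpea_cyl eval_term_op map_tuple1. Qed.

Lemma eval_tpea_perm i j u : eval v (tpea_perm i j u) = tpea_perm i j (eval v u).
Proof. by rewrite /tpea_perm eval_term_op map_tuple1. Qed.

Lemma eval_tpea_diag i j : eval v (tpea_diag T i j) = tpea_diag A i j.
Proof. by rewrite /tpea_diag eval_term_op; congr (op A _ _); apply: val_inj. Qed.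

Lemma eval_cylset G u :
  eval v (cylset (@tpea_cyl T) G u) = cylset (@tpea_cyl A) G (eval v u).
Proof.
by rewrite /cylset; elim: (enum G) => //= i l IHl; rewrite eval_tpea_cyl IHl.
Qed.

Lemma eval_word_op (w : seq (gen n)) u :
  eval v (tpea_word w u) = tpea_word w (eval v u).
Proof.
rewrite /tpea_word; elim: w => //= -[] [i j] w <-; rewrite /= ?eval_tpea_perm //.
rewrite /repl; case: eqP => //= _.
by rewrite /meet eval_tpea_cyl !(eval_tpea_neg, eval_tpea_add) eval_tpea_diag.
Qed.

End EvalTranspositional.

Section DerivedPolyadic.
Variable A : algebra (tpea_signature n).
Local Notation A' := (derived pea_in_tpea A).

Lemma derived_pea_add : @pea_add A' = @tpea_add A.
Proof.
by do 2![apply: functional_extensionality => ?]; exact: (@eval_tpea_add A 2).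
Qed.

Lemma derived_pea_neg : @pea_neg A' = @tpea_neg A.
Proof. by apply: functional_extensionality => ?; exact: (@eval_tpea_neg A 1). Qed.

Lemma derived_pea_cyl : @pea_cyl A' = cylset (@tpea_cyl A).
Proof.
by do 2![apply: functional_extensionality => ?]; exact: (@eval_cylset A 1).
Qed.

Lemma derived_pea_diag : @pea_diag A' = @tpea_diag A.
Proof.
by do 2![apply: functional_extensionality => ?]; exact: (@eval_tpea_diag A 0).
Qed.

Lemma derived_pea_subst : @pea_subst A' = fun t => @tpea_word A (word_of t).
Proof.
by do 2![apply: functional_extensionality => ?]; exact: (@eval_word_op A 1).
Qed.

Lemma derived_pea : TPEA A -> PEA A'.
Proof.
move=> KA.
change (pea_axioms (@pea_add A') (@pea_neg A') (@pea_cyl A') (@pea_subst A')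
                   (@pea_diag A')).
rewrite derived_pea_add derived_pea_neg derived_pea_cyl derived_pea_subst.
by rewrite derived_pea_diag; apply: tpea_pea KA.
Qed.

End DerivedPolyadic.

Section DerivedTranspositional.
Variable B : algebra (pea_signature n).
Local Notation B' := (derived tpea_in_pea B).

Let eval1 (o : pea_symbol n) m (v : m.-tuple B) := @eval_term_op _ B m v o.

Lemma derived_tpea_add : @tpea_add B' = @pea_add B.
Proof.
apply: functional_extensionality => x; apply: functional_extensionality => y.
by rewrite /tpea_add /= (@eval1 PAdd) map_tuple2.
Qed.

Lemma derived_tpea_neg : @tpea_neg B' = @pea_neg B.
Proof.
apply: functional_extensionality => x.
by rewrite /tpea_neg /= (@eval1 PNeg) map_tuple1.
Qed.

Lemma derived_tpea_cyl : @tpea_cyl B' = cyl1 (@pea_cyl B).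
Proof.
apply: functional_extensionality => i; apply: functional_extensionality => x.
by rewrite /tpea_cyl /= (@eval1 (PCyl _)) map_tuple1.
Qed.

Lemma derived_tpea_perm : @tpea_perm B' = swap (@pea_subst B).
Proof.
apply: functional_extensionality => i; apply: functional_extensionality => j.
apply: functional_extensionality => x.
by rewrite /tpea_perm /= (@eval1 (PSubst _)) map_tuple1.
Qed.

Lemma derived_tpea_diag : @tpea_diag B' = @pea_diag B.
Proof.
apply: functional_extensionality => i; apply: functional_extensionality => j.
by rewrite /tpea_diag /= (@eval1 (PDiag _ _)); congr (op B _ _); apply: val_inj.
Qed.

Lemma derived_tpea : PEA B -> TPEA B'.
Proof.
move=> LB.
change (tpea_axioms (@tpea_add B') (@tpea_neg B') (@tpea_cyl B') (@tpea_diag B')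
                    (@tpea_perm B')).
rewrite derived_tpea_add derived_tpea_neg derived_tpea_cyl derived_tpea_diag.
by rewrite derived_tpea_perm; apply: pea_tpea LB.
Qed.

End DerivedTranspositional.

Lemma tpea_roundtrip (A : algebra (tpea_signature n)) : TPEA A -> forall o v,
  op (derived tpea_in_pea (derived pea_in_tpea A)) o v = op A o v.
Proof.
move=> KA; set B := derived pea_in_tpea A; case=> [||i|i j|i j] v.
- by rewrite -(tuple2_eta v) -![op _ _ _]/(tpea_add _ _)
  derived_tpea_add derived_pea_add.
- by rewrite -(tuple1_eta v) -![op _ _ _]/(tpea_neg _)
  derived_tpea_neg derived_pea_neg.
- rewrite -(tuple1_eta v) -![op _ _ _]/(tpea_cyl _ _)
  derived_tpea_cyl /cyl1 derived_pea_cyl.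
  exact: cylset1.
- by rewrite -(tuple0_eta v) -![op _ _ _]/(tpea_diag _ _ _)
  derived_tpea_diag derived_pea_diag.
- rewrite -(tuple1_eta v) -![op _ _ _]/(tpea_perm _ _ _)
  derived_tpea_perm /swap derived_pea_subst.
  rewrite /tpea_word (eq_word_op KA (w' := [:: inl (i, j)])) // => k.
  by rewrite word_ofE ffunE.
Qed.

Lemma pea_roundtrip (B : algebra (pea_signature n)) : PEA B -> forall o v,
  op (derived pea_in_tpea (derived tpea_in_pea B)) o v = op B o v.
Proof.
move=> LB; set A := derived tpea_in_pea B; case=> [||G|t|i j] v.
- by rewrite -(tuple2_eta v) -![op _ _ _]/(pea_add _ _)
  derived_pea_add derived_tpea_add.
- by rewrite -(tuple1_eta v) -![op _ _ _]/(pea_neg _)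
  derived_pea_neg derived_tpea_neg.
- rewrite -(tuple1_eta v) -![op _ _ _]/(pea_cyl _ _)
  derived_pea_cyl derived_tpea_cyl.
  exact: (pea_cylset LB).
- rewrite -(tuple1_eta v) -![op _ _ _]/(pea_subst _ _)
  derived_pea_subst.
  rewrite /tpea_word derived_tpea_add derived_tpea_neg derived_tpea_cyl.
  rewrite derived_tpea_diag derived_tpea_perm.
  exact/(pea_word_op LB)/word_ofE.
- by rewrite -(tuple0_eta v) -![op _ _ _]/(pea_diag _ _ _)
  derived_pea_diag derived_tpea_diag.
Qed.

End Interpretations.

Theorem theorem7 (n : nat) (n_ge3 : 3 <= n) :
  term_definitionally_equivalent (@TPEA n) (@PEA n).
Proof.
exists (@pea_in_tpea n), (@tpea_in_pea n); split.
- exact: derived_pea.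
- exact: derived_tpea.
- exact: tpea_roundtrip.
- exact: pea_roundtrip.
Qed.
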